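(* $\mathsf{OCA}_{\mathrm T}$ implies $\mathsf{OCA}^\sharp$.
   Context: For a separable metric space $X$, $[X]^2$ is the set of unordered pairs of distinct points, identified with symmetric subsets of $X^2\setminus\mathrm{Diag}_X$ where $\mathrm{Diag}_X=\{(x,x):x\in X\}$, and topologized accordingly. $\mathsf{OCA}_{\mathrm T}$: for every separable metric space $X$ and every open $K_0\subseteq[X]^2$, either there is an uncountable $Y\subseteq X$ with $[Y]^2\subseteq K_0$, or $X=\bigcup_n X_n$ with $[X_n]^2\cap K_0=\emptyset$ for all $n$. For distinct $a,b\in\{0,1\}^{\mathbb N}$ let $\Delta(a,b)=\min\{n:a(n)\ne b(n)\}$ and $a\wedge b=a\restriction\Delta(a,b)\in\{0,1\}^{<\mathbb N}$; for $Z\subseteq\{0,1\}^{\mathbb N}$ let $\Delta(Z)=\{a\wedge b: a,b\in Z, a\ne b\}$; $|s|$ is the length of $s\in\{0,1\}^{<\mathbb N}$. $\mathsf{OCA}^\sharp$ is the statement: Suppose $X$ is a separable metric space and for each $j\in\mathbb N$, $\mathcal V_j$ is a countable family of symmetric open subsets of $X^2\setminus\mathrm{Diag}_X$, such that $\bigcup\mathcal V_j\supseteq\bigcup\mathcal V_{j+1}$ for all $j$. Then either (1) there are sets $X_n$ ($n\in\mathbb N$) with $X=\bigcup_n X_n$ and $[X_n]^2\cap\bigcup\mathcal V_n=\emptyset$ for all $n$; or (2) there are an uncountable $Z\subseteq\{0,1\}^{\mathbb N}$, an injective $f\colon Z\to X$, and $\rho\colon\Delta(Z)\to\bigcup_j\mathcal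 V_j$ such that $\rho(s)\in\mathcal V_{|s|}$ for all $s\in\Delta(Z)$ and $\{f(a),f(b)\}\in\rho(a\wedge b)$ for all distinct $a,b\in Z$. *)

(* Defs.v *)
From mathcomp Require Import all_boot all_order all_algebra.
From mathcomp Require Import all_classical all_reals all_analysis.

Set Implicit Arguments.
Unset Strict Implicit.
Unset Printing Implicit Defensive.

Local Open Scope classical_set_scope.

Definition separable_space (T : topologicalType) : Prop :=
  exists2 D : set T, countable D & dense D.

Section Pairs.
Context {T : topologicalType}.

(* [Y]^2, represented by the symmetric set of ordered pairs of distinct
   points of Y. *)
Definition pairs (Y : set T) : set (T * T) :=
  [set p | [/\ Y p.1, Y p.2 & p.1 <> p.2]].

(* Openness is relative to the subspace topology on X^2 \ Diag. *)
Definition open_symmetric (K : set (T * T)) : Prop :=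
  [/\ K `<=` pairs [set: T],
      (forall x y, K (x, y) -> K (y, x)) &
      @open (subspace (pairs [set: T])) K].

End Pairs.

Definition OCA_T (R : realType) : Prop :=
  forall X : metricType R, separable_space X ->
  forall K0 : set (X * X), open_symmetric K0 ->
    (exists2 Y : set X, ~ countable Y & pairs Y `<=` K0) \/
    (exists2 Xn : nat -> set X,
       [set: X] = \bigcup_n Xn n & forall n, pairs (Xn n) `&` K0 = set0).

(* [first_diff a b] is the least n with a n <> b n, or None when a = b; the
   junk value 0 below is thus taken only when a = b. *)
Definition Delta (a b : nat -> bool) : nat := odflt 0%N (first_diff a b).

Definition wedge (a b : nat -> bool) : seq bool := mkseq a (Delta a b).

Definition Delta_set (Z : set (nat -> bool)) : set (seq bool) :=
  [set s | exists a b, [/\ Z a, Z b, a <> b & s = wedge a b]].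

(* In the second alternative f and rho are total functions, constrained only
   on Z and on Delta_set Z respectively. Since Z is uncountable, hence nonempty,
   every function defined on Z alone extends to such a total f. *)
Definition OCA_sharp (R : realType) : Prop :=
  forall X : metricType R, separable_space X ->
  forall V : nat -> set (set (X * X)),
    (forall j, countable (V j)) ->
    (forall j, V j `<=` open_symmetric) ->
    (forall j, \bigcup_(U in V j.+1) U `<=` \bigcup_(U in V j) U) ->
    (exists2 Xn : nat -> set X,
       [set: X] = \bigcup_n Xn n &
       forall n, pairs (Xn n) `&` \bigcup_(U in V n) U = set0) \/
    (exists (Z : set (nat -> bool)) (f : (nat -> bool) -> X)
            (rho : seq bool -> set (X * X)),
       [/\ ~ countable Z,
           set_inj Z f,
           (forall s, Delta_set Z s -> V (size s) (rho s)) &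
           forall a b, Z a -> Z b -> a <> b ->
             rho (wedge a b) (f a, f b)]).

(* Main.v *)
(* Apply OCA_T to X x N^N, where z in N^N encodes a branch a_z of the binary tree
   and a sequence c_z of labels, and colour the pair (x, z), (y, w) when a_z and
   a_w first differ at n, c_z(n) = c_w(n) = k and (x, y) lies in the k-th member
   of V_n. An uncountable homogeneous set is the graph of a function on a set of
   branches, and the common label at a splitting node s defines rho(s). If
   instead X x N^N is a union of sets Y_n without coloured pairs, then by the
   Baire category theorem every x has some n and some finite sequence t such that
   the slice of Y_n over x is dense in the cone of t. For fixed n and t, two such
   points x, y cannot form a pair in any U in V_|t|: extending t by the two
   numbers that carry the label of U and opposite bits would give a coloured pair
   in Y_n. *)
Require Import Defs.
From HB Require Import structures.
From mathcomp Require Import all_boot all_order all_algebra.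
From mathcomp Require Import all_classical all_reals all_analysis.

Set Implicit Arguments.
Unset Strict Implicit.
Unset Printing Implicit Defensive.

Import Order.TTheory GRing.Theory Num.Theory.
Local Open Scope classical_set_scope.
Local Open Scope ring_scope.

(** * Baire space and products as separable metric spaces *)

(* The parameter R is a phantom: it selects the real type in which the metric
   below takes its values. *)
Definition baire_space (R : realType) : Type := nat -> nat.

HB.instance Definition _ (R : realType) := Choice.copy (baire_space R) (nat -> nat).

Definition baire_dist (R : realType) (z w : nat -> nat) : R :=
  if first_diff z w is Some n then n.+1%:R^-1 else 0.

Lemma baire_dist_lt (R : realType) (z w : nat -> nat) n :
  (baire_dist R z w < n.+1%:R^-1) <-> (forall i, (i <= n)%N -> z i = w i).
Proof.
rewrite /baire_dist; case E: (first_diff z w) => [m|].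
  move/first_diff_SomeP: E => [zw dm].
  rewrite ltf_pV2 ?posrE// ltr_nat ltnS; split=> [nm i ni|].
    by apply: zw; apply: leq_ltn_trans nm.
  by move=> h; rewrite ltnNge; apply/negP => /h /eqP; rewrite (negbTE dm).
move/first_diff_NoneP: E => ->; split=> // _; by rewrite invr_gt0.
Qed.

Lemma baire_dist_ge0 (R : realType) (z w : nat -> nat) : 0 <= baire_dist R z w.
Proof. by rewrite /baire_dist; case: first_diff => [n|//]; rewrite invr_ge0. Qed.

Section baire_metric.
Variable R : realType.
Implicit Types z w : baire_space R.

Let distxx z : baire_dist R z z = 0.
Proof. by have /first_diff_NoneP := erefl z; rewrite /baire_dist => ->. Qed.

Let dist_positivity z w : baire_dist R z w = 0 -> z = w.
Proof.
rewrite /baire_dist; case E: (first_diff _ _) => [n|]; last first.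
  by move=> _; apply/first_diff_NoneP.
by move/eqP; rewrite invr_eq0 pnatr_eq0.
Qed.

Let dist_sym z w : baire_dist R z w = baire_dist R w z.
Proof. by rewrite /baire_dist first_diff_sym. Qed.

Let dist_triangle w z z' :
  baire_dist R z z' <= baire_dist R z w + baire_dist R w z'.
Proof.
rewrite {1}/baire_dist; case E: (first_diff _ _) => [n|]; last first.
  by rewrite addr_ge0// baire_dist_ge0.
move/first_diff_SomeP: E => [_ /eqP zz'].
(* If both summands were below [n.+1%:R^-1], then [z] and [z'] would agree with [w] up to and
   including [n], where they differ. *)
have [/baire_dist_lt zw|zw] := ltP (baire_dist R z w) n.+1%:R^-1; last first.
  by rewrite (le_trans zw)// lerDl baire_dist_ge0.
have [/baire_dist_lt wz|wz] := ltP (baire_dist R w z') n.+1%:R^-1; last first.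
  by rewrite (le_trans wz)// lerDr baire_dist_ge0.
by case: zz'; rewrite zw// wz.
Qed.

HB.instance Definition _ := @isMetric.Build R (baire_space R) (baire_dist R)
  distxx dist_positivity dist_sym dist_triangle.

End baire_metric.

Section prod_metric.
Variables (R : realType) (U V : metricType R).
Implicit Types p q : U * V.

(** With the maximum, balls are exactly products of balls, so the metric is compatible with the
    product structure already on [U * V]. *)
Let dist p q : R := Order.max (mdist p.1 q.1) (mdist p.2 q.2).

Let dist_ge0 p q : 0 <= dist p q.
Proof. by rewrite le_max mdist_ge0. Qed.

Let dist_positivity p q : dist p q = 0 -> p = q.
Proof.
case: p q => [x y] [x' y'] /= d0; congr pair; apply: mdist_positivity;
  apply/eqP; rewrite eq_le mdist_ge0 andbT -d0 le_max lexx ?orbT//.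
Qed.

Let ballEdist p (e : R) : ball p e = [set q | dist p q < e].
Proof.
apply/seteqP; split => q /=; rewrite /ball/= /prod_ball !ballEmdist/= /dist gt_max.
  by move=> [-> ->].
by move=> /andP[].
Qed.

HB.instance Definition _ := @PseudoMetric_isMetric.Build R (U * V)%type dist
  dist_ge0 dist_positivity ballEdist.

End prod_metric.

Lemma near_baire (R : realType) (z : baire_space R) n :
  \forall w \near z, forall i, (i <= n)%N -> z i = w i.
Proof.
have := @nbhsx_ballx R _ z n.+1%:R^-1 _; rewrite invr_gt0 ltr0n => /(_ isT).
by apply: filterS => w; rewrite ballEmdist /= => /baire_dist_lt.
Qed.

Lemma separable_baire (R : realType) : separable_space (baire_space R).
Proof.
(* The default 0 of [nth] pads finite sequences: the dense set consists of the eventually zero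
   sequences. *)
exists (range (fun s : seq nat => nth 0%N s : baire_space R)).
  exact: card_le_trans (card_image_le _ _) (countableP _).
move=> O [z Oz] oO.
have /nbhs_ballP[e /= e0 zO] : nbhs z O by exact: open_nbhs_nbhs.
have [n ne] : exists n : nat, n.+1%:R^-1 < e.
  exists (Num.truncn e^-1).
  rewrite invf_plt ?posrE// truncnS_gt//.
exists (nth 0%N (mkseq z n.+1)); split; last by exists (mkseq z n.+1).
apply: zO; rewrite ballEmdist /=; apply: lt_trans ne.
by apply/baire_dist_lt => i ni; rewrite nth_mkseq.
Qed.

Lemma separable_prod (T T' : topologicalType) :
  separable_space T -> separable_space T' -> separable_space (T * T')%type.
Proof.
move=> [D cD dD] [E cE dE]; exists (D `*` E).
  exact: countableX.
move=> O [[x y] Oxy] oO.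
have [[A B] /= [xA yB] ABO] : nbhs (x, y) O by exact: open_nbhs_nbhs.
have [|a [/interior_subset Aa Da]] := dD A^° _ (@open_interior _ A).
  by exists x.
have [|b [/interior_subset Bb Eb]] := dE B^° _ (@open_interior _ B).
  by exists y.
by exists (a, b); split => //; apply: ABO.
Qed.

Lemma open_pairs (R : realType) (X : metricType R) : open (pairs [set: X]).
Proof.
rewrite openE => -[x y] [_ _ /= /eqP xy].
have := @metric_hausdorff R X; rewrite open_hausdorff => /(_ x y xy).
move=> [[A B] /= [/set_mem xA /set_mem yB] [oA oB /eqP AB0]].
exists (A, B) => /=; first by split; exact: open_nbhs_nbhs.
move=> [a b] [/= Aa Bb]; split => //= ab.
by have : (A `&` B) a by [rewrite ab in Aa *|]; rewrite AB0.
Qed.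

(** The complement of the diagonal is itself open, so relative openness is openness in the
    square. *)
Lemma open_symmetric_open (R : realType) (X : metricType R) (U : set (X * X)) :
  open_symmetric U -> open U.
Proof.
move=> [UP _ /open_subspaceP[W oW WU]].
rewrite (_ : U = W `&` pairs [set: X]); first exact: openI oW (@open_pairs R X).
by rewrite WU; apply/esym/setIidl.
Qed.


(** * Baire category on finite sequences *)

Definition extends (t : seq nat) (z : nat -> nat) := mkseq z (size t) = t.

Lemma extends_cat t u z : extends (t ++ u) z -> extends t z.
Proof.
rewrite /extends size_cat /mkseq iotaD map_cat => /eqP.
by rewrite eqseq_cat ?size_map ?size_iota// => /andP[/eqP].
Qed.

Lemma nth_extends t z i : extends t z -> (i < size t)%N -> z i = nth 0%N t i.
Proof. by move=> tz it; rewrite -[in RHS]tz nth_mkseq. Qed.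

Lemma baire_somewhere_dense (C : nat -> set (nat -> nat)) :
  \bigcup_n C n = [set: nat -> nat] ->
  exists n t, forall u, exists2 z, C n z & extends (t ++ u) z.
Proof.
move=> CT; apply: contrapT => nd.
have /choice[step stepP] : forall nt : nat * seq nat, exists u,
    forall z, extends (nt.2 ++ u) z -> ~ C nt.1 z.
  move=> [n t] /=; apply: contrapT => nu; apply: nd; exists n, t => u.
  apply: contrapT => nz; apply: nu; exists u => z tuz Cz.
  by apply: nz; exists z.
(* Stage [n] extends [T n] so as to avoid [C n]; the appended 0 forces the lengths to grow, so that
   the limit [z] is determined everywhere and avoids every [C n]. *)
pose fix T n := if n is m.+1 then rcons (T m ++ step (m, T m)) 0%N else [::].
have sT n : (n <= size (T n))%N.
  by elim: n => //= n ih; rewrite size_rcons ltnS size_cat (leq_trans ih)// leq_addr.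
have Tpre m n : (m <= n)%N -> exists u, T n = T m ++ u.
  move=> /subnKC <-; elim: (n - m)%N => [|k [u uE]].
    by exists [::]; rewrite addn0 cats0.
  exists (rcons (u ++ step ((m + k)%N, T (m + k)%N)) 0%N).
  by rewrite addnS /= {1}uE -catA rcons_cat.
pose z i := nth 0%N (T i.+1) i.
have zE n : extends (T n) z.
  apply: (@eq_from_nth _ 0%N); rewrite size_mkseq// => i iT.
  rewrite nth_mkseq// /z; case: (leqP n i.+1) => ni.
    by have [u ->] := Tpre _ _ ni; rewrite nth_cat iT.
  by have [u ->] := Tpre _ _ (ltnW ni); rewrite nth_cat sT.
have [n _ Cnz] : (\bigcup_n C n) z by rewrite CT.
apply: (stepP (n, T n)) Cnz => /=.
by apply: (@extends_cat _ [:: 0%N]); rewrite cats1; exact: (zE n.+1).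
Qed.

(** * Reindexing of countable covers *)

Lemma disjoint_pairsP (T : topologicalType) (Y : set T) (K : set (T * T)) :
  pairs Y `&` K = set0 <-> (forall x y, Y x -> Y y -> x <> y -> ~ K (x, y)).
Proof.
split=> [YK x y Yx Yy xy Kxy|YK]; first by rewrite -[False]/(set0 (x, y)) -YK.
by rewrite -subset0 => -[x y] [[/= Yx Yy xy] Kxy]; exact: YK Kxy.
Qed.

(* The sets A p are enumerated sparsely, as 2 ^ pickle p * (j p).*2.+1, so that
   the index given to A p is at least j p. *)
Lemma cover_reindex (T : topologicalType) (W : nat -> set (T * T))
    (I : countType) (j : I -> nat) (A : I -> set T) :
  (forall n, W n.+1 `<=` W n) ->
  [set: T] = \bigcup_p A p ->
  (forall p, pairs (A p) `&` W (j p) = set0) ->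
  exists2 Xn : nat -> set T,
    [set: T] = \bigcup_n Xn n & forall n, pairs (Xn n) `&` W n = set0.
Proof.
move=> Wd AT AW.
have Wle m n : (m <= n)%N -> W n `<=` W m.
  by move=> /subnKC <-; elim: (n - m)%N => [|k ih]; rewrite ?addn0// addnS => x /Wd /ih.
pose idx p := (2 ^ pickle p * (j p).*2.+1)%N.
(* The second factor of [idx p] is odd, so the 2-adic valuation recovers [pickle p]. *)
have idx_inj : injective idx.
  move=> p q /(congr1 (logn 2)); rewrite /idx !lognM ?expn_gt0// !pfactorK//.
  have l0 k : logn 2 k.*2.+1 = 0%N by rewrite logn_coprime// coprime2n /= odd_double.
  by rewrite !l0 !addn0 => /(pcan_inj pickleK).
have idx_ge p : (j p <= idx p)%N.
  rewrite /idx (@leq_trans (j p).*2.+1)//; last by rewrite leq_pmull ?expn_gt0.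
  by rewrite -addnn -addnS leq_addr.
(* Each index carries at most one [A p], and the empty set if it is not of the form [idx p]. As [W]
   decreases, avoiding [W (j p)] suffices to avoid [W (idx p)]. *)
exists (fun n => [set x | exists2 p, n = idx p & A p x]).
  apply/seteqP; split=> // x _.
  have [p _ Apx] : (\bigcup_p A p) x by rewrite -AT.
  by exists (idx p) => //; exists p.
move=> n; apply/disjoint_pairsP => x y [p -> Apx] [q /idx_inj <- Apy] xy.
move=> /(Wle _ _ (idx_ge p)); have /disjoint_pairsP := AW p; exact.
Qed.

Definition splits_at (n : nat) (a b : nat -> bool) : Prop :=
  (forall i, (i < n)%N -> a i = b i) /\ a n <> b n.

Lemma splits_at_Delta n a b : splits_at n a b -> Delta a b = n.
Proof.
move=> [ab abn]; rewrite /Delta.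
suff /first_diff_SomeP -> : same_prefix n a b /\ a n != b n by [].
by split=> //; exact/eqP.
Qed.

(** * The colouring and its two alternatives *)

Section coding.
Variables (R : realType) (X : metricType R) (V : nat -> set (set (X * X))).
Hypothesis V_open : forall j, V j `<=` open_symmetric.
Variable code : nat -> set (X * X) -> nat.

(* A point z of the Baire space encodes the branch [branch z] of the binary tree
   together with the labels (z n)./2, which guess the code of an element of
   V n. *)
Definition branch (z : nat -> nat) (n : nat) : bool := odd (z n).

Definition coloring : set ((X * baire_space R) * (X * baire_space R)) :=
  [set pq | exists n U, [/\ V n U, U (pq.1.1, pq.2.1),
     splits_at n (branch pq.1.2) (branch pq.2.2),
     (pq.1.2 n)./2 = code n U & (pq.2.2 n)./2 = code n U]].

Lemma coloring_open_symmetric : open_symmetric coloring.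
Proof.
split.
- move=> [[x z] [y w]] [n [U [/= VU Uxy _ _ _]]]; split=> //= -[xy _].
  by have [UP _ _] := V_open VU; have [_ _] := UP _ Uxy; apply.
- move=> [x z] [y w] [n [U /= [VU Uxy [zw zwn] zU wU]]].
  exists n, U; split=> //=; first by have [_ UC _] := V_open VU; exact: UC.
  by split=> [i /zw|] //; apply/nesym.
- apply: open_subspaceW; rewrite openE => -[[x z] [y w]] /=.
  move=> [n [U /= [VU Uxy [zw zwn] zU wU]]].
  have [[A B] /= [xA yB] ABU] : nbhs (x, y) U.
    by apply: open_nbhs_nbhs; split=> //; exact: open_symmetric_open (V_open VU).
  (* The splitting and the labels at [n] depend only on the coordinates up to and including [n]. *)
  pose N v : set (baire_space R) := [set v' | forall i, (i <= n)%N -> v i = v' i].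
  exists (A `*` N z, B `*` N w) => /=.
    split; [exists (A, N z)|exists (B, N w)] => //=;
      by split=> //; exact: near_baire.
  move=> [[x' z'] [y' w']] /= [[Ax' Nz'] [By' Nw']].
  exists n, U; split=> //=.
  + exact: (ABU (x', y')).
  + split=> [i ni|]; rewrite /branch -Nz' -?Nw' ?(ltnW ni)//.
    exact: zw.
  + by rewrite -Nz'.
  + by rewrite -Nw'.
Qed.

Lemma somewhere_dense_slices_free (Y : set (X * baire_space R)) (t : seq nat) :
  pairs Y `&` coloring = set0 ->
  pairs [set x | forall u, exists2 z, Y (x, z) & extends (t ++ u) z]
    `&` \bigcup_(U in V (size t)) U = set0.
Proof.
move=> /disjoint_pairsP Yfree; apply/disjoint_pairsP => x y Yx Yy xy [U VU Uxy].
have [z Yz tz] := Yx [:: (code (size t) U).*2].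
have [w Yw tw] := Yy [:: (code (size t) U).*2.+1].
have zt : z (size t) = (code (size t) U).*2.
  by rewrite (nth_extends tz) ?size_cat ?addn1// nth_cat ltnn subnn.
have wt : w (size t) = (code (size t) U).*2.+1.
  by rewrite (nth_extends tw) ?size_cat ?addn1// nth_cat ltnn subnn.
apply: (Yfree _ _ Yz Yw); first by case.
exists (size t), U; split=> //=; last 2 first.
- by rewrite zt doubleK.
- by rewrite wt /= uphalf_double.
split=> [i it|]; last by rewrite /branch zt wt /= odd_double.
rewrite /branch (nth_extends (extends_cat tz))//.
by rewrite (nth_extends (extends_cat tw)).
Qed.

Hypothesis code_inj : forall n, {in V n &, injective (code n)}.

Lemma homogeneous_embedding (Y : set (X * baire_space R)) :
  ~ countable Y -> pairs Y `<=` coloring ->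
  exists (Z : set (nat -> bool)) (f : (nat -> bool) -> X)
         (rho : seq bool -> set (X * X)),
    [/\ ~ countable Z,
        set_inj Z f,
        (forall s, Delta_set Z s -> V (size s) (rho s)) &
        forall a b, Z a -> Z b -> a <> b -> rho (wedge a b) (f a, f b)].
Proof.
move=> Ync YK.
have [p0 _] : Y !=set0.
  by apply: contrapT => /set0P/negP; rewrite negbK => /eqP Y0; apply: Ync; rewrite Y0.
pose br (p : X * baire_space R) := branch p.2.
(* Distinct points of [Y] form a coloured pair, so their branches must split somewhere. *)
have br_inj : {in Y &, injective br}.
  move=> p q /set_mem Yp /set_mem Yq pq; apply: contrapT => npq.
  have [n [U [_ _ [_ + _ _]]]] := YK (p, q) (And3 Yp Yq npq).
  by rewrite -/(br p) -/(br q) pq.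
pose Z := br @` Y.
have Znc : ~ countable Z.
  by move=> cZ; apply: Ync; rewrite -(eq_countable (inj_card_eq br_inj)).
have /choice[g gP] : forall a, exists p, Z a -> Y p /\ br p = a.
  move=> a; have [[p Yp pa]|nZ] := pselect (Z a); first by exists p.
  by exists p0.
have gK a b : Z a -> Z b -> a <> b -> exists n U,
    [/\ V n U, U ((g a).1, (g b).1), splits_at n a b,
    ((g a).2 n)./2 = code n U & ((g b).2 n)./2 = code n U].
  move=> Za Zb ab; have [Ya ga] := gP _ Za; have [Yb gb] := gP _ Zb.
  have [|n [U [/= VU Uab]]] := YK (g a, g b).
    by split=> //= gab; apply: ab; rewrite -ga -gb gab.
  by rewrite -!/(br _) ga gb => ? ? ?; exists n, U.
pose f a := (g a).1.
(* One pair [a0], [b0] meeting at [s] selects [U0]; injectivity of [code n] then shows that every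
   other pair meeting at [s] uses the same set. *)
have /choice[rho rhoP] : forall s, exists U, Delta_set Z s ->
    V (size s) U /\ forall a b, Z a -> Z b -> a <> b -> wedge a b = s -> U (f a, f b).
  move=> s; have [|nD] := pselect (Delta_set Z s); last by exists set0.
  move=> [a0 [b0 [Za0 Zb0 ab0 ->]]].
  have [n [U0 [VU0 _ s0 ca0 cb0]]] := gK _ _ Za0 Zb0 ab0.
  exists U0 => _; rewrite /wedge (splits_at_Delta s0) size_mkseq; split=> //.
  move=> a b Za Zb ab.
  have [m [U [VU Uab sab ca cb]]] := gK _ _ Za Zb ab.
  rewrite (splits_at_Delta sab) => eqs.
  have mn : m = n by move/(congr1 size): eqs; rewrite !size_mkseq.
  subst m.
  have aa0 i : (i < n)%N -> a i = a0 i.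
    by move=> ni; rewrite -(nth_mkseq false a ni) eqs nth_mkseq.
  have label c : Z c -> splits_at n a c -> ((g a).2 n)./2 = ((g c).2 n)./2.
    move=> Zc sac; have ac : a <> c by move=> ac; case: sac; rewrite ac.
    have [k [U' [_ _ sk ka kc]]] := gK _ _ Za Zc ac.
    by rewrite -(splits_at_Delta sac) (splits_at_Delta sk) ka kc.
  (* At n the bit of a differs from that of a0 or of b0, so a splits there from
     one of them and shares its label, which is the code of U0. *)
  have cUU0 : code n U = code n U0.
    rewrite -ca; have [aan|aan] := eqVneq (a n) (a0 n); last first.
      by rewrite (label a0) //; split=> //; exact/eqP.
    rewrite (label b0) //; case: s0 => s0 s0n.
    by split=> [i ni|]; rewrite ?aan// aa0// s0.
  by have <- : U = U0 by apply: (@code_inj n); rewrite ?inE.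
exists Z, f, rho; split=> //.
- move=> a b /set_mem Za /set_mem Zb fab; apply: contrapT => ab.
  have [n [U [VU Uab _ _ _]]] := gK _ _ Za Zb ab.
  by have [UP _ _] := V_open VU; have [_ _] := UP _ Uab; apply.
- by move=> s /rhoP[].
- move=> a b Za Zb ab; have [|_] := rhoP (wedge a b); first by exists a, b.
  exact.
Qed.

End coding.

Theorem theorem3p3 (R : realType) : OCA_T R -> OCA_sharp R.
Proof.
move=> oca X sX V cV oV dV.
have /choice[code code_inj] : forall n, exists c : set (X * X) -> nat,
    {in V n &, injective c}.
  by move=> n; exact/countable_injP.
have [[Y Ync YK]|[Y YT YK]] := oca _ (separable_prod sX (separable_baire R)) _
  (coloring_open_symmetric oV code).
  by right; exact: homogeneous_embedding YK.
left.
(* The piece for [(n, t)] avoids level [size t], which is unrelated to [n]; hence the reindexing. *)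
pose A (p : nat * seq nat) := [set x | forall u,
  exists2 z, Y p.1 (x, z) & extends (p.2 ++ u) z].
apply: (@cover_reindex X _ _ (fun p => size p.2) A dV).
  apply/seteqP; split=> // x _.
  have [|n [t nt]] := @baire_somewhere_dense (fun n => [set z | Y n (x, z)]).
    apply/seteqP; split=> // z _.
    have [n _ Yn] : (\bigcup_n Y n) (x, z) by rewrite -YT.
    by exists n.
  by exists (n, t).
by move=> [n t]; exact: somewhere_dense_slices_free (YK n).
Qed.
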